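(* Let $f\in\mathbb{R}[x,y]$ be regular in $x$, let $x=\gamma(y)$ be a Newton--Puiseux root of $f$, let $\rho=\rho(\gamma,f)$ be the contact order of $\gamma$ and $f$, and let $\tilde\gamma$ be the truncated Newton--Puiseux root associated to $\gamma$. Then: (i) If $\tilde\gamma$ is real, then $\gamma$ is a real Newton--Puiseux root of $f$. (ii) Write $f(X+\tilde\gamma(Y),Y)=\sum c_{ij}X^iY^{j/N}$. Then the multiplicity $\mathrm{mult}_\gamma f$ of $\gamma$ as a root of $f$ equals $$\min\{\, i \mid i\rho+j/N=\mathrm{ord}\, f(\tilde\gamma_\rho(y),y)\ \text{and}\ c_{ij}\neq0\,\},$$ where $\tilde\gamma_\rho$ is the $\rho$-approximation of $\tilde\gamma$. (iii) Let $g\in\mathbb{R}[x,y]$ be regular in $x$ and let $h:=\gcd(f,g)$. If $\tilde\gamma$ is a Newton--Puiseux root $\bmod\ \rho(\gamma,f)+$ of $h$, then $\gamma$ is also a Newton--Puiseux root of $g$.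
   Context: A polynomial $f$ with $f(0,0)=0$, written $f=f_m+f_{m+1}+\cdots$ ($f_k$ homogeneous of degree $k$, $f_m\not\equiv0$), is regular in $x$ if $f_m(1,0)\neq0$. A Puiseux series is an element $\phi(y)=\sum_i a_iy^{\alpha_i}\in\mathbb{C}\{y^{1/N}\}$ with positive rational exponents; it is real if all its coefficients are real. A Newton--Puiseux root of $f$ is a Puiseux series $\gamma$ with $f(\gamma(y),y)\equiv0$; $\mathcal V(f)$ is the set of all of them, and $\mathrm{mult}_\gamma f$ is the largest $m$ with $f=(x-\gamma(y))^m h$, $h(\gamma(y),y)\not\equiv0$. The contact order of a Puiseux series $\varphi$ with $f$ is $\rho(\varphi,f):=\max\{\mathrm{ord}(\varphi(y)-\gamma'(y))\mid \varphi\neq\gamma'\in\mathcal V(f)\}$. If $\gamma(y)=\sum c_\alpha y^\alpha$ is a Newton--Puiseux root of $f$ and $\rho=\rho(\gamma,f)$, its truncated Newton--Puiseux root is $\tilde\gamma(y):=\sum_{\alpha\le\rho}c_\alpha y^\alpha$. For $\rho>0$, the $\rho$-approximation of a Puiseux series $\phi(y)=\sum_i a_iy^{\alpha_i}$ is $\sum_{\alpha_i<\rho}a_iy^{\alpha_i}+cy^\rho$ with $c$ a generic real number. For a rational $q$, a Puiseux series $\varphi$ is a Newton--Puiseux root $\bmod\ q+$ of $h$ if there is a Newton--Puiseux root $\xi$ of $h$ with $\mathrm{ord}(\varphi(y)-\xi(y))>q$. *)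

(* Defs.v *)
(* R : realType (the real numbers), C := R[i] (complex numbers
   from mathcomp-real-closed).  Bivariate polynomials R[x,y] are encoded as
   {poly {poly R}}: the OUTER variable is x, the inner (coefficient) variable is y,
   so  f`_i`_j  is the coefficient of x^i y^j. *)
From HB Require Import structures.
From mathcomp Require Import all_boot all_order all_algebra.
From mathcomp Require Import complex.
From mathcomp Require Import reals.
Set Implicit Arguments. Unset Strict Implicit. Unset Printing Implicit Defensive.
Import Order.TTheory GRing.Theory Num.Theory.
Local Open Scope ring_scope.

(* A Puiseux series  sum_{k>=1} a_k y^{k/N}  with positive exponents, given by
   its denominator N = pden and its coefficient sequence a = pser (in C). *)
Record pseries (C : Type) := PSeries { pden : nat; pser : nat -> C }.

Section Puiseux.
Variable R : realType.
Local Notation C := (complex R).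

Definition toC (x : R) : C := Complex x 0.

Definition ps_valid (phi : pseries C) : Prop :=
  (0 < pden phi)%N /\ pser phi 0 = 0.

Definition pcoef (phi : pseries C) (q : rat) : C :=
  let r := q * (pden phi)%:R in
  if (denq r == 1) && (0 <= numq r) then pser phi (absz (numq r)) else 0.

(* equality of Puiseux series (as series, independently of the chosen N) *)
Definition peq (phi psi : pseries C) : Prop := forall q, pcoef phi q = pcoef psi q.

Definition diffc (phi psi : pseries C) : rat -> C :=
  fun q => pcoef phi q - pcoef psi q.

Definition is_ord (c : rat -> C) (o : rat) : Prop :=
  c o != 0 /\ forall r, r < o -> c r = 0.

(* ord c > q  (with the convention ord 0 = +oo) *)
Definition ord_gt (c : rat -> C) (q : rat) : Prop :=
  forall r, r <= q -> c r = 0.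

Definition trunc (a : nat -> C) (n : nat) : {poly C} := \poly_(k < n.+1) a k.

(* f(x, t^N) with complex coefficients, t = y^{1/N} *)
Definition liftf (f : {poly {poly R}}) (N : nat) : {poly {poly C}} :=
  map_poly (fun p : {poly R} => (map_poly toC p) \Po 'X^N) f.

(* coefficient function (in y-exponents) of the series f(phi(y), y):
   the coefficient of t^n = y^{n/N} of f(phi(t), t^N) only depends on the
   truncation of phi to degree n. *)
Definition evalc (f : {poly {poly R}}) (phi : pseries C) : rat -> C :=
  pcoef (PSeries (pden phi)
    (fun n => ((liftf f (pden phi)).[trunc (pser phi) n])`_n)).

Definition is_np_root (f : {poly {poly R}}) (phi : pseries C) : Prop :=
  ps_valid phi /\ forall q, evalc f phi q = 0.

Definition contact_order (f : {poly {poly R}}) (phi : pseries C) (rho : rat) : Prop :=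
  (exists g', is_np_root f g' /\ ~ peq phi g' /\ is_ord (diffc phi g') rho) /\
  (forall g' o, is_np_root f g' -> ~ peq phi g' -> is_ord (diffc phi g') o ->
     o <= rho).

Definition trunc_root (g : pseries C) (rho : rat) : pseries C :=
  PSeries (pden g)
    (fun k => if k%:R / (pden g)%:R <= rho then pser g k else 0).

Definition ps_real (phi : pseries C) : Prop :=
  forall q, complex.Im (pcoef phi q) = 0.

Definition rho_approx (phi : pseries C) (rho : rat) (c : R) : pseries C :=
  let N := (pden phi * absz (denq rho))%N in
  PSeries N (fun k => let q := k%:R / N%:R in
                      if q < rho then pcoef phi q
                      else if q == rho then toC c else 0).

(* c_ij : coefficient of X^i Y^{j/N} in f(X + phi(Y), Y), N = pden phi *)
Definition shiftc (f : {poly {poly R}}) (phi : pseries C) (i j : nat) : C :=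
  (((liftf f (pden phi)) \Po ('X + (trunc (pser phi) j)%:P))`_i)`_j.

(* polynomial in x whose coefficients are power series in t, truncated in t *)
Definition hpoly (h : seq (nat -> C)) (n : nat) : {poly {poly C}} :=
  \poly_(i < size h) trunc (nth (fun _ => 0) h i) n.

(* f = (x - g(y))^m h  with h(g(y), y) not identically 0, where h is a
   polynomial in x with coefficients power series in t = y^{1/N}, N = pden g;
   the identity is the identity of formal power series, checked
   coefficientwise on truncations. *)
Definition mult_factor (f : {poly {poly R}}) (g : pseries C) (m : nat) : Prop :=
  exists h : seq (nat -> C),
    (forall n i, ((liftf f (pden g))`_i)`_n =
        ((('X - (trunc (pser g) n)%:P) ^+ m * hpoly h n)`_i)`_n) /\
    (exists n, ((hpoly h n).[trunc (pser g) n])`_n != 0).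

Definition is_mult (f : {poly {poly R}}) (g : pseries C) (m : nat) : Prop :=
  mult_factor f g m /\ forall m', mult_factor f g m' -> (m' <= m)%N.

(* f regular in x: f(0,0)=0, f = f_m + f_{m+1} + ..., f_m <> 0, f_m(1,0) <> 0 *)
Definition regular_in_x (f : {poly {poly R}}) : Prop :=
  exists m : nat, (0 < m)%N /\
    (forall i j, (i + j < m)%N -> f`_i`_j = 0) /\ f`_m`_0 != 0.

Definition pdvd (d a : {poly {poly R}}) : Prop := exists q, a = q * d.

Definition is_gcd (f g h : {poly {poly R}}) : Prop :=
  pdvd h f /\ pdvd h g /\ forall d, pdvd d f -> pdvd d g -> pdvd d h.

End Puiseux.

(* Main.v *)
Require Import Defs.
From HB Require Import structures.
From mathcomp Require Import all_boot all_order all_algebra ring.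
From mathcomp Require Import complex.
From mathcomp Require Import boolp reals.
Set Implicit Arguments. Unset Strict Implicit. Unset Printing Implicit Defensive.
Import Order.TTheory GRing.Theory Num.Theory.
Local Open Scope ring_scope.

(** The one deep ingredient is that a root of f agreeing with gamma up to and
    including exponent rho is gamma itself, by maximality of rho.  Applied to the
    complex conjugate of gamma it gives (i), applied to the common root xi it
    gives (iii).  For (ii), rescale X by y^rho in f(X + gamma, y) and divide by
    the largest power of y: the result is y^w G(X), and modulo positive powers of
    y, G is the initial form on the line of weight w, the same for gamma and for
    its truncation.  If m is the multiplicity then X^m divides G; if the
    coefficient of X^m in the initial form vanished, the Newton-Puiseux theorem
    would give a nonzero root of G / X^m of positive order, hence a root of f
    different from gamma but agreeing with it up to rho. *)

(** * Formal power series *)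

(* Wrapped in a record because the plain function type [nat -> K] already carries
   the pointwise ring structure. *)
Record fps (K : Type) := Fps { fcoef :> nat -> K }.

Lemma fpsP (K : Type) (a b : fps K) : (forall n, a n = b n) -> a = b.
Proof. by case: a b => [a] [b] /= ab; congr Fps; apply/funext. Qed.

HB.instance Definition _ (K : Type) := gen_eqMixin (fps K).
HB.instance Definition _ (K : Type) := gen_choiceMixin (fps K).

Section FpsRing.
Variable K : comNzRingType.
Implicit Types (a b c : fps K) (p q : {poly K}).

Definition fzero : fps K := Fps (fun=> 0).
Definition fopp a : fps K := Fps (fun n => - a n).
Definition fadd a b : fps K := Fps (fun n => a n + b n).
Definition fone : fps K := Fps (fun n => (n == 0)%:R).
Definition fmul a b : fps K := Fps (fun n => \sum_(i < n.+1) a i * b (n - i)%N).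

Fact faddA : associative fadd.
Proof. by move=> a b c; apply: fpsP => n /=; rewrite addrA. Qed.
Fact faddC : commutative fadd.
Proof. by move=> a b; apply: fpsP => n /=; rewrite addrC. Qed.
Fact fadd0 : left_id fzero fadd.
Proof. by move=> a; apply: fpsP => n /=; rewrite add0r. Qed.
Fact faddN : left_inverse fzero fopp fadd.
Proof. by move=> a; apply: fpsP => n /=; rewrite addNr. Qed.

HB.instance Definition _ := GRing.isZmodule.Build (fps K) faddA faddC fadd0 faddN.

Definition trunc_fps n a : {poly K} := \poly_(k < n.+1) a k.

(* The ring laws are inherited from {poly K}: a coefficient of a product only
   depends on truncations of the factors. *)
Definition agree n a p := forall k, (k <= n)%N -> a k = p`_k.

Lemma agree_trunc n a : agree n a (trunc_fps n a).
Proof. by move=> k kn; rewrite coef_poly ltnS kn. Qed.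

Lemma agree_mul n a b p q : agree n a p -> agree n b q -> agree n (fmul a b) (p * q).
Proof.
move=> ap bq k kn; rewrite coefM /=; apply: eq_bigr => i _.
by rewrite ap ?bq ?(leq_trans (leq_subr _ _)) ?(leq_trans (leq_ord i)).
Qed.

Lemma agree_eq a b : (forall n, exists p, agree n a p /\ agree n b p) -> a = b.
Proof.
move=> ab; apply: fpsP => n; have [p [ap bp]] := ab n.
by rewrite ap // bp.
Qed.

Fact fmulA : associative fmul.
Proof.
move=> a b c; apply: agree_eq => n.
exists (trunc_fps n a * (trunc_fps n b * trunc_fps n c)); split.
  by do 2?apply: agree_mul; apply: agree_trunc.
by rewrite mulrA; do 2?apply: agree_mul; apply: agree_trunc.
Qed.

Fact fmulC : commutative fmul.
Proof.
move=> a b; apply: agree_eq => n; exists (trunc_fps n a * trunc_fps n b).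
by split; last rewrite mulrC; apply: agree_mul; apply: agree_trunc.
Qed.

Fact fmul1 : left_id fone fmul.
Proof.
move=> a; apply: fpsP => n /=; rewrite big_ord_recl /= mul1r subn0.
by rewrite big1 ?addr0 // => i _; rewrite mul0r.
Qed.

Fact fmulDl : left_distributive fmul fadd.
Proof.
move=> a b c; apply: fpsP => n /=; rewrite -big_split /=.
by apply: eq_bigr => i _; rewrite mulrDl.
Qed.

Fact fone_neq0 : fone != 0.
Proof.
by apply/eqP => /(congr1 (fun a : fps K => a 0%N)) /= /eqP; rewrite oner_eq0.
Qed.

HB.instance Definition _ :=
  GRing.Zmodule_isComNzRing.Build (fps K) fmulA fmulC fmul1 fmulDl fone_neq0.

Lemma coef_fpsD a b n : (a + b) n = a n + b n. Proof. by []. Qed.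
Lemma coef_fpsB a b n : (a - b) n = a n - b n. Proof. by []. Qed.
Lemma coef_fpsM a b n : (a * b) n = \sum_(i < n.+1) a i * b (n - i)%N.
Proof. by []. Qed.
Lemma coef_fps_sum I (r : seq I) (P : pred I) (F : I -> fps K) n :
  (\sum_(i <- r | P i) F i) n = \sum_(i <- r | P i) F i n.
Proof. by elim/big_rec2: _ => // i x y _ <-. Qed.

Lemma agreeM n a b p q : agree n a p -> agree n b q -> agree n (a * b) (p * q).
Proof. exact: agree_mul. Qed.

Definition coef0_fps a : K := a 0%N.

Fact coef0_fps_is_zmod : zmod_morphism coef0_fps.
Proof. by []. Qed.
Fact coef0_fps_is_monoid : monoid_morphism coef0_fps.
Proof.
split=> // a b; rewrite /coef0_fps coef_fpsM big_ord_recl big_ord0 addr0.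
by rewrite subn0.
Qed.
HB.instance Definition _ := GRing.isZmodMorphism.Build _ _ coef0_fps coef0_fps_is_zmod.
HB.instance Definition _ := GRing.isMonoidMorphism.Build _ _ coef0_fps coef0_fps_is_monoid.

Definition poly_fps p : fps K := Fps (fun n => p`_n).

Fact poly_fps_is_zmod : zmod_morphism poly_fps.
Proof. by move=> p q; apply: fpsP => n; rewrite coef_fpsB /= coefB. Qed.
Fact poly_fps_is_monoid : monoid_morphism poly_fps.
Proof.
split=> [|p q]; apply: fpsP => n; first by rewrite /= coef1.
by rewrite coef_fpsM /= coefM.
Qed.
HB.instance Definition _ := GRing.isZmodMorphism.Build _ _ poly_fps poly_fps_is_zmod.
HB.instance Definition _ := GRing.isMonoidMorphism.Build _ _ poly_fps poly_fps_is_monoid.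

(* The substitution t |-> t^M. *)
Definition stretch M a : fps K := Fps (fun n => if (M %| n)%N then a (n %/ M)%N else 0).

Lemma agree_stretch M n a p : (0 < M)%N -> agree n a p -> agree n (stretch M a) (p \Po 'X^M).
Proof.
move=> M0 ap k kn; rewrite coef_comp_poly_Xn //=; case: ifP => // _.
by rewrite ap // (leq_trans (leq_div _ _)).
Qed.

Fact stretch_is_zmod M : zmod_morphism (stretch M).
Proof. by move=> a b; apply: fpsP => n; rewrite coef_fpsB /=; case: ifP; rewrite ?subr0. Qed.
Fact stretch_is_monoid M : monoid_morphism (stretch M).
Proof.
split=> [|a b].
  apply: fpsP => -[|n]; rewrite /= ?dvdn0 ?div0n //.
  case: ifP => // /dvdnP [k n_eq]; rewrite n_eq mulnK; last first.
    by case: (M) n_eq => //; rewrite muln0.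
  by case: k n_eq.
(* For M = 0 the divisibility test passes only at n = 0, so [stretch 0 a] is the constant series
   with value [a 0]. It is still multiplicative, hence [stretch] is a ring morphism without a
   positivity condition. *)
have [->|M0] := posnP M.
  apply: fpsP => n; rewrite [RHS]coef_fpsM; case: n => [|n].
    rewrite big_ord1; exact: (coef0_fps_is_monoid.2 a b).
  rewrite big1 // => -[[|i] i_n] _ /=.
    by rewrite mulr0.
  by rewrite mul0r.
apply: agree_eq => n; exists ((trunc_fps n a * trunc_fps n b) \Po 'X^M).
split; first by apply: agree_stretch => //; apply: agreeM; apply: agree_trunc.
by rewrite comp_polyM; apply: agreeM; apply: agree_stretch => //; apply: agree_trunc.
Qed.
HB.instance Definition _ M :=
  GRing.isZmodMorphism.Build _ _ (stretch M) (stretch_is_zmod M).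
HB.instance Definition _ M :=
  GRing.isMonoidMorphism.Build _ _ (stretch M) (stretch_is_monoid M).

Lemma stretch_poly M p : (0 < M)%N -> stretch M (poly_fps p) = poly_fps (p \Po 'X^M).
Proof. by move=> M0; apply: fpsP => n; rewrite /= coef_comp_poly_Xn. Qed.

Lemma stretch_mul M a k : (0 < M)%N -> stretch M a (k * M)%N = a k.
Proof. by move=> M0 /=; rewrite dvdn_mull // mulnK. Qed.

Lemma stretch0E M a : stretch M a 0%N = a 0%N.
Proof. by rewrite /= dvdn0 div0n. Qed.

Lemma stretch_inj M : (0 < M)%N -> injective (stretch M).
Proof.
by move=> M0 a b ab; apply: fpsP => n; rewrite -(stretch_mul a n M0) ab stretch_mul.
Qed.

Lemma stretch_stretch M N a : (0 < M)%N -> (0 < N)%N ->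
  stretch M (stretch N a) = stretch (N * M) a.
Proof.
move=> M0 N0; apply: fpsP => n /=.
have [/dvdnP[k ->]|Mn] := boolP (M %| n)%N.
  by rewrite mulnK // dvdn_pmul2r // divnMr.
by case: ifP => // /(dvdn_trans (dvdn_mull _ (dvdnn _))); rewrite (negPf Mn).
Qed.

Definition fT : fps K := poly_fps 'X.
Definition fC (c : K) : fps K := poly_fps c%:P.
Definition shift_fps n a : fps K := Fps (fun k => a (k + n)%N).

Lemma coef_fTM n a k : (fT ^+ n * a) k = if (k < n)%N then 0 else a (k - n)%N.
Proof.
have -> : (fT ^+ n * a) k = ('X^n * trunc_fps k a)`_k.
  by apply: (agreeM _ (agree_trunc _)) => // j _; rewrite -rmorphXn.
by rewrite coefXnM; case: ltnP => // nk; rewrite coef_poly ltnS leq_subr.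
Qed.

Lemma fTM_shift n a : (forall k, (k < n)%N -> a k = 0) -> a = fT ^+ n * shift_fps n a.
Proof.
move=> a0; apply: fpsP => k; rewrite coef_fTM; case: ltnP => [/a0 //|nk] /=.
by rewrite subnK.
Qed.

Lemma fTM_inj n a b : fT ^+ n * a = fT ^+ n * b -> a = b.
Proof.
move=> ab; apply: fpsP => k.
have := congr1 (fun c : fps K => c (k + n)%N) ab.
by rewrite !coef_fTM ltnNge leq_addl /= addnK.
Qed.

Lemma stretch_fT M : (0 < M)%N -> stretch M fT = fT ^+ M.
Proof. by move=> M0; rewrite stretch_poly // comp_polyX rmorphXn. Qed.

Lemma coef_fCM (c : K) a n : (fC c * a) n = c * a n.
Proof.
rewrite coef_fpsM big_ord_recl /= coefC /= subn0 big1 ?addr0 // => i _.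
by rewrite coefC mul0r.
Qed.

(** Congruence modulo the ideal generated by t^n, as [eqmP] makes explicit. *)
Definition eqm n a b := forall k, (k < n)%N -> a k = b k.

Lemma eqmP n a b : eqm n a b <-> exists c, a = b + fT ^+ n * c.
Proof.
split=> [ab|[c ->] k kn]; last by rewrite coef_fpsD coef_fTM kn addr0.
have ab0 k : (k < n)%N -> (a - b) k = 0 by move=> kn; rewrite coef_fpsB ab ?subrr.
by exists (shift_fps n (a - b)); rewrite -(fTM_shift ab0) addrC subrK.
Qed.

Lemma eqmM n a a' b b' : eqm n a a' -> eqm n b b' -> eqm n (a * b) (a' * b').
Proof.
move=> aa' bb' k kn; rewrite !coef_fpsM; apply: eq_bigr => i _.
by rewrite aa' ?bb' // (leq_ltn_trans _ kn) ?leq_subr // leq_ord.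
Qed.

Lemma eqm_sum n I (r : seq I) (F G : I -> fps K) :
  (forall i, eqm n (F i) (G i)) -> eqm n (\sum_(i <- r) F i) (\sum_(i <- r) G i).
Proof.
by move=> FG k kn; rewrite !coef_fps_sum; apply: eq_bigr => i _; apply: FG.
Qed.

Lemma eqm_trunc n a : eqm n.+1 (poly_fps (trunc_fps n a)) a.
Proof. by move=> k kn; rewrite /= coef_poly kn. Qed.

End FpsRing.
Arguments fT {K}.
Arguments stretch K M a : simpl never.
Arguments coef0_fps K a : simpl never.

(** * The Newton-Puiseux theorem *)

Section PolyComp.
Variable A : comNzRingType.
Implicit Types (p : {poly A}) (c x h : A).

Lemma coef_comp_XaddC p c k : (p \Po ('X + c%:P))`_k = p^`N(k).[c].
Proof.
elim/poly_ind: p k => [|p d IH] k.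
  by rewrite comp_poly0 coef0 nderivn_poly0 ?size_poly0 // horner0.
rewrite comp_polyD comp_polyM comp_polyX comp_polyC mulrDr coefD coefD coefMC.
rewrite coefMX coefC.
case: k => [|k]; first by rewrite /= nderivn0 IH nderivn0 !hornerE.
by rewrite nderivnMXaddC hornerD hornerMX /= addr0 !IH.
Qed.

Lemma coef_comp_scaleX p c k : (p \Po (c *: 'X))`_k = c ^+ k * p`_k.
Proof.
elim/poly_ind: p k => [|p d IH] k; first by rewrite comp_poly0 coef0 mulr0.
rewrite comp_polyD comp_polyM comp_polyX comp_polyC -scalerAr !coefD coefZ !coefMX !coefC.
case: k => [|k] /=; first by rewrite mulr0 !add0r expr0 mul1r.
by rewrite IH !addr0 exprS mulrA.
Qed.

Lemma horner_taylor2 p x h : exists r, p.[x + h] = p.[x] + p^`().[x] * h + h ^+ 2 * r.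
Proof.
elim/poly_ind: p => [|p d [r IH]].
  by exists 0; rewrite deriv0 !horner0 mul0r mulr0 !addr0.
exists (p^`().[x] + r * (x + h)).
by rewrite derivMXaddC !hornerE IH; ring.
Qed.

End PolyComp.

Lemma stretch1 (K : comNzRingType) : stretch 1 =1 @id (fps K).
Proof. by move=> a; apply: fpsP => n; rewrite /stretch /= dvd1n divn1. Qed.

(** * Hensel's lemma for a simple root of the polynomial mod t *)

Section Hensel.
Variable K : fieldType.
Implicit Types (G : {poly fps K}) (a x y : fps K).

Lemma coef0_horner G x : G.[x] 0%N = (map_poly (@coef0_fps K) G).[x 0%N].
Proof. by rewrite -/(coef0_fps x) horner_map. Qed.

Lemma coef0_map G i : (map_poly (@coef0_fps K) G)`_i = G`_i 0%N.
Proof. by rewrite coef_map. Qed.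

(* The chord iteration x |-> x - u^-1 G(x), with u = G_1(0), gains one order of
   agreement at each step. *)
Lemma hensel G : G`_0 0%N = 0 -> G`_1 0%N != 0 ->
  exists x : fps K, x 0%N = 0 /\ G.[x] = 0.
Proof.
move=> G0; set u := G`_1 0%N => u0.
pose step x := x - fC u^-1 * G.[x].
have G_0 x : x 0%N = 0 -> G.[x] 0%N = 0.
  by move=> x0; rewrite coef0_horner x0 horner_coef0 coef0_map.
have step_0 x : x 0%N = 0 -> step x 0%N = 0.
  by move=> x0; rewrite coef_fpsB coef_fCM G_0 // mulr0 subr0.
have step_eqm n x y : x 0%N = 0 -> y 0%N = 0 -> eqm n.+1 x y -> eqm n.+2 (step x) (step y).
  move=> x0 y0 /eqmP[e xe]; set h := fT ^+ n.+1 * e in xe.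
  have [r Gr] := horner_taylor2 G y h.
  have h0 : coef0_fps h = 0 by rewrite /coef0_fps coef_fTM.
  (* By Taylor's formula [step x - step y = h * v]. The constant term of G'(y) is u, so v vanishes
     at t = 0, and this gives the extra power of t. *)
  pose v := 1 - fC u^-1 * (G^`().[y] + h * r).
  have v0 : coef0_fps v = 0.
    have G'0 : coef0_fps G^`().[y] = u.
      by rewrite /coef0_fps coef0_horner y0 horner_coef0 coef0_map coef_deriv.
    have C0 : coef0_fps (fC u^-1) = u^-1 by rewrite /coef0_fps /= coefC.
    rewrite /v rmorphB rmorphM rmorphD (rmorphM _ h r) rmorph1 /= h0.
    by rewrite G'0 mul0r addr0 C0 mulVf ?subrr.
  apply/eqmP.
  have ev0 k : (k < 1)%N -> (e * v) k = 0.
    by case: k => // _; rewrite -/(coef0_fps _) (rmorphM _ e v) /= v0 mulr0.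
  exists (shift_fps 1 (e * v)); rewrite exprSr -mulrA -{1}[fT]expr1 -(fTM_shift ev0).
  by rewrite mulrA -/h /step xe Gr /v; ring.
pose s n := iter n step 0.
have s_0 n : s n 0%N = 0 by elim: n => [|n IH]; [ | exact: (step_0 (s n) IH)].
have s_eqm n : eqm n.+1 (s n) (s n.+1).
  elim: n => [|n IH]; last exact: (step_eqm _ _ _ (s_0 n) (s_0 n.+1) IH).
  by case=> // _; rewrite !s_0.
(* The k-th coefficient no longer changes from [s k] on, so the diagonal is the t-adic limit. *)
pose x := Fps (fun k => s k k).
have s_x n : eqm n.+1 (s n) x.
  elim: n => [|n IH] k; first by case: k.
  rewrite ltnS leq_eqVlt => /orP[/eqP -> //|kn].
  by rewrite -s_eqm // IH.
have x0 : x 0%N = 0 by [].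
have step_x : step x = x.
  apply: fpsP => n.
  have sx := step_eqm _ _ _ (s_0 n) x0 (s_x n).
  by rewrite -sx //; apply: (s_x n.+1).
exists x; split=> //; apply: fpsP => n; apply: (mulfI (invr_neq0 u0)).
rewrite -coef_fCM mulr0; have /eqP := step_x.
by rewrite /step subr_eq addrC -subr_eq subrr => /eqP <-.
Qed.

End Hensel.

(** Split off the power of X in g. A constant cofactor would make g a monomial, against its two
    nonzero coefficients; otherwise the cofactor has a root, and it does not vanish at 0. *)
Lemma ex_nonzero_root (K : closedFieldType) (g : {poly K}) i j :
  i != j -> g`_i != 0 -> g`_j != 0 -> exists2 z, z != 0 & root g z.
Proof.
move=> ij gi gj; have [m [q /implyP q0 gE]] := multiplicity_XsubC g 0.
have g0 : g != 0 by apply: contraNneq gi => ->; rewrite coef0.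
move: q0 => /(_ g0) q0; rewrite subr0 in gE.
have [/size_poly1P[c c0 qc]|/closed_rootP[z qz]] := boolP (size q == 1)%N.
  case/eqP: ij; move: gi gj; rewrite gE qc !coefCM !coefXn.
  by have [->|_] := eqVneq i m; have [->|_] := eqVneq j m; rewrite ?mulr0 ?eqxx.
exists z; last by rewrite gE rootM qz.
by apply: contraNneq q0 => <-.
Qed.

(* The hypotheses make [G] mod t a nonzero polynomial vanishing at 0 (of any
   order <= d).  Translating by a root of the (d-1)-st derivative kills the
   coefficient of X^(d-1); after one Newton polygon step the reduced polynomial,
   of degree d without X^(d-1) term, then has a nonzero root of multiplicity
   < d.  All slopes become integral at once by ramifying to order d!. *)
Theorem newton_puiseux (K : closedFieldType) (charK : forall n, n.+1%:R != 0 :> K)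
    (G : {poly fps K}) (d : nat) :
  G`_0 0%N = 0 -> G`_d 0%N != 0 ->
  exists M (x : fps K), [/\ (0 < M)%N, x 0%N = 0 & (map_poly (stretch M) G).[x] = 0].
Proof.
elim/ltn_ind: d G => d IH G G00 Gd.
(* If a smaller index also works, induction applies at once; otherwise d is the exact order of G mod
   t at 0. *)
have [/existsP[i Gi]|/existsPn Gmin] := boolP [exists i : 'I_d, G`_i 0%N != 0].
  exact: IH (ltn_ord i) _ G00 Gi.
have {}Gmin i : (i < d)%N -> G`_i 0%N = 0.
  by move=> id; apply/eqP; have := Gmin (Ordinal id); rewrite negbK.
have coef0_muln (a : fps K) n : (a *+ n) 0%N = a 0%N *+ n.
  by rewrite -/(coef0_fps _) rmorphMn.
case: d => [|e] in IH Gd Gmin *; first by rewrite G00 eqxx in Gd.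
(* The e-th normalized derivative has constant coefficient G_e, zero mod t, and linear coefficient d
   G_d, nonzero mod t in characteristic 0: Hensel's lemma applies. *)
have [x [x0 xroot]] : exists x : fps K, x 0%N = 0 /\ G^`N(e).[x] = 0.
  apply: hensel; rewrite coef_nderivn coef0_muln.
    by rewrite addn0 Gmin // mul0rn.
  by rewrite addn1 binSn -mulr_natr mulf_neq0.
pose G1 := G \Po ('X + x%:P).
have G1e : G1`_e = 0 by rewrite coef_comp_XaddC.
have G1_0 i : G1`_i 0%N = G`_i 0%N.
  rewrite -!coef0_map map_comp_poly rmorphD /= map_polyX map_polyC /=.
  by rewrite [coef0_fps x]x0 addr0 comp_polyXr.
have [G1z|/eqP G1nz] := eqVneq G1`_0 0.
  exists 1%N, x; split=> //; rewrite (eq_map_poly (@stretch1 K)) map_poly_id //.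
  by rewrite -G1z coef_comp_XaddC nderivn0.
have [j0 G1j0] : exists j, G1`_0 j != 0.
  apply/not_existsP => G1j; case: G1nz; apply: fpsP => j.
  by have /negP := G1j j; rewrite negbK => /eqP.
set d := e.+1 in IH Gd Gmin *; pose q := d`!.
have q0 : (0 < q)%N by apply: fact_gt0.
(* p/q = j/(d - i) is the inclination of the segment from (i, j) to (d, 0) in the Newton diagram; p
   is an integer because d - i divides d!. The least p gives the edge ending at (d, 0), and the
   support with i < d lies on or above its line. *)
pose slope p := `[< exists i j, [/\ (i < d)%N, G1`_i j != 0 & (q * j = p * (d - i))%N] >].
have slopeP i j : (i < d)%N -> G1`_i j != 0 -> slope (q %/ (d - i) * j)%N.
  move=> id Gij; apply/asboolP; exists i, j; split=> //.
  by rewrite mulnAC divnK // dvdn_fact // subn_gt0 id leq_subr.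
have ex_slope : exists p, slope p by exists (q %/ (d - 0) * j0)%N; apply: slopeP.
case: (ex_minnP ex_slope) => p /asboolP[i1 [j1 [i1d Gij1 pij1]]] p_min.
have below i j : (i < d)%N -> G1`_i j != 0 -> (p * (d - i) <= q * j)%N.
  move=> id Gij; have /p_min := slopeP i j id Gij.
  rewrite -(leq_pmul2r (m := d - i)) ?subn_gt0 // mulnAC divnK //.
  by rewrite dvdn_fact // subn_gt0 id leq_subr.
have p0 : (0 < p)%N.
  case: (posnP p) pij1 Gij1 => // -> /eqP; rewrite mul0n muln_eq0 gtn_eqF //=.
  by move=> /eqP ->; rewrite G1_0 Gmin ?eqxx.
pose G1s := map_poly (stretch q) G1.
have G1sE i k : G1s`_i k != 0 -> exists2 j, k = (q * j)%N & G1`_i j != 0.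
  rewrite coef_map /stretch /=; case: ifP => [/dvdnP[j ->]|_]; last by rewrite eqxx.
  by rewrite mulnK // => Gij; exists j; rewrite 1?mulnC.
pose E := G1s \Po (fT ^+ p *: 'X).
have EE i k : E`_i k = if (k < p * i)%N then 0 else G1s`_i (k - p * i)%N.
  by rewrite coef_comp_scaleX -exprM coef_fTM.
have E0 i k : (k < p * d)%N -> E`_i k = 0.
  move=> kd; rewrite EE; case: ltnP => // ik; apply/eqP/negPn/negP => /G1sE[j kj Gij].
  have id : (i < d)%N by rewrite -(ltn_pmul2l p0) (leq_ltn_trans ik).
  have := below i j id Gij; rewrite -kj mulnBr leqNgt ltn_sub2r //.
  by rewrite ltn_pmul2l.
pose G2 := map_poly (shift_fps (p * d)) E.
have shift0 : shift_fps (p * d) (0 : fps K) = 0 by apply: fpsP.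
have EG2 : E = (fT ^+ (p * d))%:P * G2.
  apply/polyP => i; rewrite coefCM coef_map_id0 // -fTM_shift // => k; exact: E0.
have G2E i : G2`_i 0%N = if (p * d < p * i)%N then 0 else G1s`_i (p * d - p * i)%N.
  by rewrite coef_map_id0 //= add0n EE.
(* g collects the coefficients on that edge. Terms of index above d vanish at t = 0 since p > 0, so
   g has degree d. *)
pose g := map_poly (@coef0_fps K) G2.
have gE i : g`_i = if (p * d < p * i)%N then 0 else G1s`_i (p * d - p * i)%N.
  by rewrite coef0_map G2E.
have gd : g`_d != 0.
  by rewrite gE ltnn subnn coef_map -/(coef0_fps _) /coef0_fps stretch0E G1_0.
have ge : g`_e = 0 by rewrite gE coef_map G1e raddf0 if_same.
have gi1 : g`_i1 != 0.
  by rewrite gE ltn_pmul2l // ltnNge ltnW //= -mulnBr -pij1 coef_map mulnC stretch_mul.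
have [z z0 zroot] := ex_nonzero_root (negbT (ltn_eqF i1d)) gi1 gd.
pose G3 := G2 \Po ('X + (fC z)%:P).
have fC0 : (fC z) 0%N = z by rewrite /= coefC.
have G3_0 : G3`_0 0%N = 0.
  by rewrite coef_comp_XaddC nderivn0 coef0_horner fC0; apply/eqP.
(* Without an X^e term, the e-th normalized derivative of g is d g_d X, nonzero at z. So z has
   multiplicity at most e, and induction applies to [G3] with e. *)
have G3_e : G3`_e 0%N != 0.
  rewrite coef_comp_XaddC coef0_horner fC0 -nderivn_map -/g.
  have -> : g^`N(e) = (g`_d *+ d) *: 'X.
    apply/polyP => -[|[|i]]; rewrite coef_nderivn coefZ coefX.
    - by rewrite addn0 ge mul0rn mulr0.
    - by rewrite addn1 binSn mulr1.
    - rewrite mulr0 gE ltn_pmul2l //.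
      by rewrite !addnS !ltnS leq_addr mul0rn.
  by rewrite hornerZ hornerX -mulr_natr; do 2?apply: mulf_neq0 => //; apply: charK.
have [M [y [M0 y0 yroot]]] := IH e (ltnSn e) G3 G3_0 G3_e.
(* The substitutions are undone in reverse order: translation by z, scaling by t^p, translation by
   x. The ramification orders multiply to q M. *)
pose y' := y + stretch M (fC z).
pose S := stretch M : {rmorphism fps K -> fps K}.
have y'root : (map_poly S G2).[y'] = 0.
  rewrite -[RHS]yroot map_comp_poly rmorphD /= map_polyX map_polyC horner_comp.
  by rewrite hornerD hornerX hornerC.
have Eroot : (map_poly S E).[y'] = 0 by rewrite EG2 rmorphM hornerM y'root mulr0.
have G1root : (map_poly (stretch (q * M)) G1).[S (fT ^+ p) * y'] = 0.
  rewrite -[RHS]Eroot [in RHS]map_comp_poly map_polyZ map_polyX horner_comp hornerZ hornerX.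
  rewrite -map_poly_comp; congr (_.[_]); apply: eq_map_poly => a /=.
  by rewrite /S stretch_stretch.
exists (q * M)%N, (S (fT ^+ p) * y' + stretch (q * M) x); split.
- by rewrite muln_gt0 q0.
- rewrite coef_fpsD stretch0E x0 addr0 -/(coef0_fps _) rmorphM /= /coef0_fps.
  by rewrite stretch0E -[fT ^+ p]mulr1 coef_fTM p0 mul0r.
- rewrite -[RHS]G1root map_comp_poly rmorphD /= map_polyX map_polyC horner_comp.
  by rewrite hornerD hornerX hornerC.
Qed.

(** * Puiseux series *)

Lemma eqm_horner (K : comNzRingType) n (P : {poly fps K}) x y :
  eqm n x y -> eqm n P.[x] P.[y].
Proof.
move=> /eqmP[c ->]; have [r ->] := horner_taylor2 P y (fT ^+ n * c).
by apply/eqmP; exists (P^`().[y] * c + fT ^+ n * c ^+ 2 * r); ring.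
Qed.

(** Links the definitions by truncation to evaluation in the series ring: altering a beyond degree n
    changes the value by a multiple of t^(n+1). *)
Lemma horner_map_poly_fps (K : comNzRingType) (P : {poly {poly K}}) (a : fps K) n :
  (P.[trunc_fps n a])`_n = (map_poly (@poly_fps K) P).[a] n.
Proof.
rewrite -(eqm_horner (map_poly (@poly_fps K) P) (@eqm_trunc _ n a)) //.
by rewrite horner_map.
Qed.

Section PuiseuxCoef.
Variable R : realType.
Local Notation C := (complex R).
Implicit Types (f g h : {poly {poly R}}) (phi psi : pseries C) (a b : fps C).

Definition fser phi : fps C := Fps (pser phi).

Lemma pcoefP phi q :
  (exists k : nat, q * (pden phi)%:R = k%:R /\ pcoef phi q = fser phi k) \/
  ((forall k : nat, q * (pden phi)%:R <> k%:R) /\ pcoef phi q = 0).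
Proof.
rewrite /pcoef; set r := q * _; case: ifP => [/andP[/eqP dr nr]|rN]; [left|right].
  exists `|numq r|%N; split=> //.
  by rewrite -{1}[r]divq_num_den dr divr1 -[in LHS](gez0_abs nr) -pmulrn.
split=> // k rk; move: rN; rewrite rk pmulrn denq_int numq_int.
by [].
Qed.

Lemma pcoef_nat N (a : nat -> C) q (k : nat) : q * N%:R = k%:R -> pcoef (PSeries N a) q = a k.
Proof.
move=> qk; case: (pcoefP (PSeries N a) q) => /= [[j [qj ->]]|[qN _]]; last by case: (qN k).
by congr (a _); apply/eqP; rewrite -(eqr_nat rat) -qj qk.
Qed.

Lemma pcoef_frac N (a : nat -> C) (k : nat) : (0 < N)%N ->
  pcoef (PSeries N a) (k%:R / N%:R) = a k.
Proof. by move=> N0; apply: pcoef_nat; rewrite divfK // pnatr_eq0 -lt0n. Qed.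

Lemma pcoef_eq0 N (a : nat -> C) : (0 < N)%N ->
  (forall q, pcoef (PSeries N a) q = 0) <-> (forall k, a k = 0).
Proof.
move=> N0; split=> [a0 k|a0 q]; first by rewrite -(pcoef_frac a k N0).
by case: (pcoefP (PSeries N a) q) => [[k [_ ->]]|[]].
Qed.

(** A multiple N M of the denominator describes the same Puiseux series: y^(1/N) is the M-th power
    of the new variable. *)
Lemma pcoef_stretch N M a q : (0 < N)%N -> (0 < M)%N ->
  pcoef (PSeries (N * M) (stretch M a)) q = pcoef (PSeries N a) q.
Proof.
move=> N0 M0; have M0' : M%:R != 0 :> rat by rewrite pnatr_eq0 -lt0n.
case: (pcoefP (PSeries N a) q) => [[k [qk ->]]|[qN ->]]; [rewrite /= in qk|rewrite /= in qN].
  have qk' : q * (N * M)%:R = (k * M)%:R by rewrite natrM mulrA qk natrM.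
  by rewrite (pcoef_nat _ qk') stretch_mul.
case: (pcoefP (PSeries (N * M) (stretch M a)) q) => [[k [qk ->]]|[]] //.
rewrite /fser /stretch /= in qk *.
case: ifP => // /dvdnP[j kj]; case: (qN j); apply: (mulIf M0').
by rewrite -natrM -kj -qk natrM mulrA.
Qed.

Definition diff_fps phi psi : fps C :=
  stretch (pden psi) (fser phi) - stretch (pden phi) (fser psi).

Lemma diffcE phi psi q : (0 < pden phi)%N -> (0 < pden psi)%N ->
  diffc phi psi q = pcoef (PSeries (pden phi * pden psi) (diff_fps phi psi)) q.
Proof.
move=> N0 M0; rewrite /diffc.
have -> : pcoef phi q = pcoef (PSeries (pden phi) (fser phi)) q by [].
have -> : pcoef psi q = pcoef (PSeries (pden psi) (fser psi)) q by [].
rewrite -(pcoef_stretch (fser phi) q N0 M0) -(pcoef_stretch (fser psi) q M0 N0).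
rewrite (mulnC (pden psi)).
set D := (_ * _)%N; case: (pcoefP (PSeries D (diff_fps phi psi)) q) => [[k [qk ->]]|[qN ->]].
  by rewrite !(pcoef_nat _ qk).
case: (pcoefP (PSeries D (stretch (pden psi) (fser phi))) q) => [[k [qk]]|[_ ->]].
  by case: (qN k).
case: (pcoefP (PSeries D (stretch (pden phi) (fser psi))) q) => [[k [qk]]|[_ ->]].
  by case: (qN k).
by rewrite subrr.
Qed.

Lemma peqP phi psi : (0 < pden phi)%N -> (0 < pden psi)%N ->
  peq phi psi <-> diff_fps phi psi = 0.
Proof.
move=> N0 M0; have NM0 : (0 < pden phi * pden psi)%N by rewrite muln_gt0 N0.
have d0 := pcoef_eq0 (diff_fps phi psi) NM0.
split=> [eq_phi|dz].
  by apply: fpsP; apply/d0 => q; rewrite -diffcE // /diffc eq_phi subrr.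
move=> q; apply/eqP; rewrite -subr_eq0 -/(diffc phi psi q) diffcE //.
by apply/eqP; move: q; apply/d0; rewrite dz.
Qed.

(** All exponents are natural multiples of one fraction, the inverse of the product of the
    denominators, so there is a least one where the coefficients differ. *)
Lemma ex_is_ord phi psi : (0 < pden phi)%N -> (0 < pden psi)%N -> ~ peq phi psi ->
  exists o, is_ord (diffc phi psi) o.
Proof.
move=> N0 M0 /(peqP N0 M0) dn0; set d := diff_fps phi psi in dn0.
have NM0 : (0 < pden phi * pden psi)%N by rewrite muln_gt0 N0.
have ex : exists n, d n != 0.
  by apply/not_existsP => dn; apply: dn0; apply: fpsP => n; apply/eqP/negPn/negP/dn.
case: (ex_minnP ex) => n dn n_min; exists (n%:R / (pden phi * pden psi)%:R); split.
  by rewrite diffcE // pcoef_frac.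
move=> r rn; rewrite diffcE //.
case: (pcoefP (PSeries (pden phi * pden psi) (diff_fps phi psi)) r) => /= [[k [rk ->]]|[_ ->] //].
apply/eqP/negPn/negP => /n_min; rewrite leqNgt => /negP[].
by rewrite -(ltr_nat rat) -rk -ltr_pdivlMr // ltr0n.
Qed.

Lemma pcoef_trunc phi rho q : (0 < pden phi)%N ->
  pcoef (trunc_root phi rho) q = if q <= rho then pcoef phi q else 0.
Proof.
move=> N0; have N0' : (pden phi)%:R != 0 :> rat by rewrite pnatr_eq0 -lt0n.
case: (pcoefP phi q) => [[k [qk ->]]|[qN ->]].
  rewrite (pcoef_nat _ qk) /=; congr (if _ then _ else _).
  by rewrite -qk mulfK.
rewrite if_same.
by case: (pcoefP (trunc_root phi rho) q) => [[k [qk _]]|[_ ->]] //; case: (qN k).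
Qed.

End PuiseuxCoef.

(** * Roots as zeros in the series ring, and parts (i) and (iii) *)

Section RootSeries.
Variable R : realType.
Local Notation C := (complex R).
Implicit Types (f g h : {poly {poly R}}) (phi psi : pseries C) (a b : fps C).

Fact toC_is_zmod : zmod_morphism (@toC R).
Proof. by move=> x y; rewrite /toC; apply/eqP; rewrite eq_complex /= subrr !eqxx. Qed.
Fact toC_is_monoid : monoid_morphism (@toC R).
Proof.
split=> // x y; apply/eqP; rewrite eq_complex /=.
by rewrite !mulr0 mul0r subr0 addr0 !eqxx.
Qed.
HB.instance Definition _ := GRing.isZmodMorphism.Build _ _ (@toC R) toC_is_zmod.
HB.instance Definition _ := GRing.isMonoidMorphism.Build _ _ (@toC R) toC_is_monoid.

Lemma liftfE f N : liftf f N = map_poly (comp_poly 'X^N \o map_poly (@toC R)) f.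
Proof. by []. Qed.

Definition liftF f N : {poly fps C} := map_poly (@poly_fps C) (liftf f N).

Lemma liftFM f g N : liftF (f * g) N = liftF f N * liftF g N.
Proof. by rewrite /liftF !liftfE !rmorphM. Qed.

Lemma map_stretch_liftF f N M : (0 < M)%N ->
  map_poly (stretch M) (liftF f N) = liftF f (N * M).
Proof.
move=> M0; apply/polyP => i.
transitivity (stretch M (poly_fps (map_poly (@toC R) f`_i \Po 'X^N))).
  by rewrite /liftF liftfE !coef_map.
rewrite stretch_poly // -comp_polyA comp_Xn_poly -exprM mulnC.
by rewrite /liftF liftfE !coef_map.
Qed.

Definition valF f phi := (liftF f (pden phi)).[fser phi].

Lemma evalcE f phi q : evalc f phi q = pcoef (PSeries (pden phi) (valF f phi)) q.
Proof.
congr (pcoef (PSeries _ _) q); apply/funext => n.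
exact: (@horner_map_poly_fps _ _ (fser phi) n).
Qed.

Lemma np_rootE f phi : ps_valid phi -> is_np_root f phi <-> valF f phi = 0.
Proof.
move=> pv; have e0 := pcoef_eq0 (valF f phi) pv.1; split=> [[_ v]|v].
  by apply: fpsP; apply/e0 => q; rewrite -evalcE.
by split=> // q; rewrite evalcE; apply/e0: q => k; rewrite v.
Qed.

Lemma stretch_horner f N M a : (0 < M)%N ->
  stretch M (liftF f N).[a] = (liftF f (N * M)).[stretch M a].
Proof. by move=> M0; rewrite -map_stretch_liftF // horner_map. Qed.

Lemma np_root_peq f phi psi : ps_valid phi -> peq phi psi ->
  is_np_root f psi -> is_np_root f phi.
Proof.
move=> pv phipsi rpsi; have pv' := rpsi.1.
move: rpsi => /(np_rootE f pv') v; apply/(np_rootE f pv).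
apply: (stretch_inj pv'.1); rewrite stretch_horner ?pv'.1 //.
have /eqP := (peqP pv.1 pv'.1).1 phipsi.
rewrite subr_eq0 => /eqP ->; rewrite mulnC -stretch_horner ?pv.1 //.
by rewrite -/(valF f psi) v !rmorph0.
Qed.

(** If the roots differed, the order o of their difference would be at most rho by maximality; but
    their coefficients agree at every exponent up to rho, hence at o. *)
Lemma contact_unique f gamma rho psi :
  contact_order f gamma rho -> is_np_root f gamma -> is_np_root f psi ->
  (forall q, q <= rho -> pcoef gamma q = pcoef psi q) -> peq gamma psi.
Proof.
move=> [_ rho_max] [gv _] rpsi agr; apply: contrapT => npeq.
have [o oP] := ex_is_ord gv.1 rpsi.1.1 npeq.
have /agr e := rho_max _ _ rpsi npeq oP.
by case: oP => /eqP[]; rewrite /diffc e subrr.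
Qed.

Definition conj_series phi : pseries C := PSeries (pden phi) (fun k => (pser phi k)^*%C).

Lemma pcoef_conj phi q : pcoef (conj_series phi) q = (pcoef phi q)^*%C.
Proof. by rewrite /pcoef /=; case: ifP => // _; rewrite rmorph0. Qed.

(** The coefficients of f are real, so conjugation fixes f and commutes with evaluation. *)
Lemma np_root_conj f phi : is_np_root f phi -> is_np_root f (conj_series phi).
Proof.
move=> [[N0 a0] ev]; split; first by split=> //=; rewrite a0 rmorph0.
move=> q; transitivity ((evalc f phi q)^*%C); last by rewrite ev rmorph0.
rewrite /evalc -pcoef_conj.
congr (pcoef (PSeries _ _) q); apply/funext => n /=.
set F := liftf f _.
have FE : map_poly (map_poly (@conjc R)) F = F.
  apply/polyP => i; rewrite /F liftfE !coef_map /= map_comp_poly map_polyXn -map_poly_comp.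
  by congr (_ \Po _); apply: eq_map_poly => x; apply/eqP; rewrite eq_complex /= oppr0 !eqxx.
have -> : trunc (fun k => (pser phi k)^*%C) n = map_poly (@conjc R) (trunc (pser phi) n).
  by apply/polyP => k; rewrite coef_map !coef_poly; case: ifP => // _; rewrite raddf0.
by rewrite -{1}FE horner_map coef_map.
Qed.

Lemma root_real f gamma rho :
  is_np_root f gamma -> contact_order f gamma rho ->
  ps_real (trunc_root gamma rho) -> ps_real gamma.
Proof.
move=> rg co treal q.
have conjE (z : C) : z = z^*%C <-> complex.Im z = 0.
  case: z => x y /=; split=> [[/eqP]|->]; last by rewrite oppr0.
  by rewrite -subr_eq0 opprK -mulr2n mulrn_eq0 => /eqP.
apply/conjE; rewrite -pcoef_conj.
apply: (contact_unique co rg (np_root_conj rg)) => r rrho.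
rewrite pcoef_conj; apply/conjE; have := treal r.
by rewrite pcoef_trunc ?rg.1.1 // rrho.
Qed.

Lemma np_root_dvd f h phi : pdvd h f -> is_np_root h phi -> is_np_root f phi.
Proof.
move=> [q ->] rh; have pv := rh.1; apply/(np_rootE _ pv).
move/(np_rootE _ pv): rh; rewrite /valF => rh.
by rewrite liftFM hornerM rh mulr0.
Qed.

(** Since h divides f, xi is a root of f and coincides with gamma by uniqueness; since h divides g,
    it is a root of g. *)
Lemma root_of_gcd f gamma rho g h xi :
  is_np_root f gamma -> contact_order f gamma rho ->
  pdvd h f -> pdvd h g -> is_np_root h xi ->
  ord_gt (diffc (trunc_root gamma rho) xi) rho -> is_np_root g gamma.
Proof.
move=> rg co hf hg rxi gt_rho.
apply: (np_root_peq rg.1 _ (np_root_dvd hg rxi)).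
apply: (contact_unique co rg (np_root_dvd hf rxi)) => q qrho.
have /eqP := gt_rho q qrho; rewrite subr_eq0 => /eqP <-.
by rewrite pcoef_trunc ?rg.1.1 // qrho.
Qed.

End RootSeries.

(** * Multiplicity of a root *)

Section Translation.
Variable A : comNzRingType.
Implicit Types (p h : {poly A}) (c x : A).

Lemma comp_XaddCK p c : (p \Po ('X + c%:P)) \Po ('X - c%:P) = p.
Proof. by rewrite -comp_polyA comp_polyD comp_polyX comp_polyC subrK comp_polyXr. Qed.

Lemma horner_comp_XaddC p c x : (p \Po ('X + c%:P)).[x] = p.[x + c].
Proof. by rewrite horner_comp hornerD hornerX hornerC. Qed.

(** After moving c to 0, a factor (X - c)^m becomes X^m, which can be split off over any commutative
    ring, and h(c) becomes the coefficient of X^m. *)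
Lemma root_factorP p c m :
  (exists2 h, p = ('X - c%:P) ^+ m * h & h.[c] != 0) <->
  (forall i, (i < m)%N -> (p \Po ('X + c%:P))`_i = 0) /\ (p \Po ('X + c%:P))`_m != 0.
Proof.
split=> [[h -> hc]|[low top]].
  have -> : (('X - c%:P) ^+ m * h) \Po ('X + c%:P) = 'X^m * (h \Po ('X + c%:P)).
    by rewrite rmorphM rmorphXn /= comp_polyB comp_polyX comp_polyC addrK.
  split=> [i im|]; rewrite coefXnM ?im // ltnn subnn.
  by rewrite coef_comp_XaddC nderivn0.
set q := p \Po _ in low top; pose h := drop_poly m q.
have qE : q = 'X^m * h.
  apply/polyP => i; rewrite coefXnM; case: ltnP => [/low //|mi].
  by rewrite coef_drop_poly subnK.
exists (h \Po ('X - c%:P)).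
  rewrite -[LHS](comp_XaddCK p c) -/q {1}qE.
  by rewrite rmorphM rmorphXn /= comp_polyX.
by rewrite horner_comp !hornerE subrr horner_coef0 coef_drop_poly add0n.
Qed.

End Translation.

Section FpsPoly.
Variable K : comNzRingType.
Implicit Types (P Q : {poly fps K}) (a x : fps K).

(** w is the least t-order among the coefficients of P. *)
Lemma fps_poly_content P : P != 0 ->
  exists w Q, P = (fT ^+ w)%:P * Q /\ exists i, Q`_i 0%N != 0.
Proof.
move=> P0; pose low w := `[< exists i, P`_i w != 0 >].
have ex : exists w, low w.
  apply: contrapT => low0; case/eqP: P0; apply/polyP => i; apply: fpsP => w.
  rewrite coef0; apply/eqP/negPn/negP => Piw; apply: low0; exists w.
  by apply/asboolP; exists i.
case: (ex_minnP ex) => w /asboolP[i Piw] w_min.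
exists w, (map_poly (shift_fps w) P).
have s0 : shift_fps w (0 : fps K) = 0 by apply: fpsP.
split; last by exists i; rewrite coef_map_id0.
apply/polyP => j; rewrite coefCM coef_map_id0 // -fTM_shift // => k kw.
apply/eqP/negPn/negP => Pjk; move: kw; rewrite ltnNge w_min //.
by apply/asboolP; exists j.
Qed.

Definition eqm_poly n P Q := forall i, eqm n P`_i Q`_i.

Lemma eqm_polyM n P P' Q Q' :
  eqm_poly n P P' -> eqm_poly n Q Q' -> eqm_poly n (P * Q) (P' * Q').
Proof. by move=> PP' QQ' i; rewrite !coefM; apply: eqm_sum => j; apply: eqmM. Qed.

Lemma eqm_polyX n P P' m : eqm_poly n P P' -> eqm_poly n (P ^+ m) (P' ^+ m).
Proof.
move=> PP'; elim: m => [|m IH]; first by move=> i k.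
by rewrite !exprS; apply: eqm_polyM.
Qed.

Lemma eqm_poly_horner n P Q a : eqm_poly n P Q -> eqm n P.[a] Q.[a].
Proof.
move=> PQ; rewrite (horner_coef_wide a (leq_maxl (size P) (size Q))).
rewrite (horner_coef_wide a (leq_maxr (size P) (size Q))).
by apply: eqm_sum => i; apply: eqmM.
Qed.

End FpsPoly.

Section Multiplicity.
Variable R : realType.
Local Notation C := (complex R).
Implicit Types (f : {poly {poly R}}) (phi : pseries C) (h : seq (nat -> C)).

Lemma shiftcE f phi i j :
  shiftc f phi i j = (liftF f (pden phi) \Po ('X + (fser phi)%:P))`_i j.
Proof.
rewrite /shiftc !coef_comp_XaddC /liftF nderivn_map.
by rewrite -horner_map_poly_fps.
Qed.

Definition fps_poly_of h : {poly fps C} :=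
  \poly_(i < size h) Fps (nth (fun=> 0) h i).

Lemma eqm_hpoly h n :
  eqm_poly n.+1 (map_poly (@poly_fps C) (hpoly h n)) (fps_poly_of h).
Proof.
move=> i k kn; rewrite coef_map !coef_poly; case: ifP => _ /=; last by rewrite coef0.
by rewrite coef_poly kn.
Qed.

(** The n-th coefficients only depend on the data modulo t^(n+1), so the identities on truncations
    amount to one factorization over the series ring. *)
Lemma mult_factorE f phi m :
  mult_factor f phi m <->
  exists2 H, liftF f (pden phi) = ('X - (fser phi)%:P) ^+ m * H & H.[fser phi] != 0.
Proof.
have factorE h n i :
    ((('X - (trunc (pser phi) n)%:P) ^+ m * hpoly h n)`_i)`_n =
    (('X - (fser phi)%:P) ^+ m * fps_poly_of h)`_i n.
  have Xa : eqm_poly n.+1 ('X - (poly_fps (trunc (pser phi) n))%:P) ('X - (fser phi)%:P).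
    move=> j k kn; rewrite !coefB !coefC !coef_fpsB; congr (_ - _).
    by case: ifP => // _; apply: (@eqm_trunc _ n (fser phi)).
  rewrite -(eqm_polyM (@eqm_polyX _ _ _ _ m Xa) (@eqm_hpoly h n)) //.
  rewrite -(map_polyX (@poly_fps C)) -map_polyC -rmorphB -rmorphXn -rmorphM.
  by rewrite coef_map.
have hornE h n : ((hpoly h n).[trunc (pser phi) n])`_n = (fps_poly_of h).[fser phi] n.
  rewrite -(@eqm_poly_horner _ _ _ _ (fser phi) (@eqm_hpoly h n)) //.
  exact: (@horner_map_poly_fps _ (hpoly h n) (fser phi) n).
have liftE n i : ((liftf f (pden phi))`_i)`_n = (liftF f (pden phi))`_i n.
  by rewrite /liftF coef_map.
split=> [[h [fE [n hn]]]|[H fE Hn]].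
  exists (fps_poly_of h).
    by apply/polyP => i; apply: fpsP => n'; rewrite -liftE fE factorE.
  by apply: contraNneq hn => h0; rewrite hornE h0.
exists (map (@fcoef C) H).
have HE : fps_poly_of (map (@fcoef C) H) = H.
  apply/polyP => i; rewrite coef_poly size_map; case: ltnP => iH.
    by apply: fpsP => n /=; rewrite (nth_map 0).
  by rewrite nth_default.
split=> [n i|]; first by rewrite factorE HE liftE fE.
apply/not_existsP => H0; case/eqP: Hn; apply: fpsP => n; rewrite -{1}HE -hornE.
by apply/eqP/negPn/negP/H0.
Qed.

Lemma is_multP f phi m :
  let P := liftF f (pden phi) \Po ('X + (fser phi)%:P) in
  (forall i, (i < m)%N -> P`_i = 0) -> P`_m != 0 -> is_mult f phi m.
Proof.
move=> P low top; split=> [|m']; first by apply/mult_factorE/root_factorP.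
move/mult_factorE/root_factorP => [low' top']; rewrite leqNgt; apply/negP => mm'.
by rewrite -/P low' ?eqxx in top.
Qed.

Lemma liftF_neq0 f N : (0 < N)%N -> regular_in_x f -> liftF f N != 0.
Proof.
move=> N0 [m [_ [_ fm]]]; apply: contraNneq fm => /(congr1 (fun P : {poly fps C} => P`_m 0%N)).
rewrite /liftF liftfE !coef_map /= coef_comp_poly_Xn // dvdn0 div0n coef_map coef0.
by move/(congr1 (@complex.Re R)) => /= ->.
Qed.

(** Supplies the finite set of non-generic constants: if [toC c - s] is a root z, then c is the real
    part of z + s. *)
Lemma finite_real_roots (p : {poly C}) (s : C) : p != 0 ->
  exists S : seq R, forall c : R, c \notin S -> ~~ root p (toC c - s).
Proof.
move=> p0; have [rs prs] := closed_field_poly_normal p.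
exists [seq complex.Re (z + s) | z <- rs] => c; apply: contra.
rewrite prs rootZ ?lead_coef_eq0 // root_prod_XsubC => cs.
by apply/mapP; exists (toC c - s); rewrite ?subrK.
Qed.

End Multiplicity.

(** * The initial form along the contact order *)

Section MultiplicityFormula.
Variable R : realType.
Local Notation C := (complex R).
Variables (f : {poly {poly R}}) (gamma : pseries C) (rho : rat).
Hypothesis f_reg : regular_in_x f.
Hypothesis gamma_root : is_np_root f gamma.
Hypothesis rho_contact : contact_order f gamma rho.

(** [D] is the denominator used by [rho_approx]; y^rho is an integral power of y^(1/D). *)
Let N := pden gamma.
Let d := absz (denq rho).
Let D := (N * d)%N.

Let N_gt0 : (0 < N)%N. Proof. exact: gamma_root.1.1. Qed.
Let d_gt0 : (0 < d)%N. Proof. by rewrite absz_gt0 denq_neq0. Qed.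
Let D_gt0 : (0 < D)%N. Proof. by rewrite muln_gt0 N_gt0. Qed.
Let D_neq0 : D%:R != 0 :> rat. Proof. by rewrite pnatr_eq0 -lt0n. Qed.

Lemma contact_ge0 : 0 <= rho.
Proof.
have [[g' [rg' [_ [c_rho _]]]] _] := rho_contact.
rewrite (diffcE _ N_gt0 rg'.1.1) in c_rho.
have NN_gt0 : (0 < pden gamma * pden g')%N by rewrite muln_gt0 N_gt0 rg'.1.1.
set ps := PSeries _ _ in c_rho; case: (pcoefP ps rho) c_rho => [[k [rk _]] _|[_ ->]].
  by rewrite -(pmulr_lge0 _ (x := (pden ps)%:R)) ?ltr0n // rk ler0n.
by rewrite eqxx.
Qed.

Lemma contact_integral : exists r : nat, rho * D%:R = r%:R.
Proof.
exists (N * `|numq rho|)%N; rewrite /D !natrM mulrCA; congr (_ * _).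
rewrite -{1}[rho]divq_num_den -[d%:R]/((Posz d)%:~R) /d absz_denq.
rewrite divfK ?intr_eq0 ?denq_neq0 //.
by rewrite -[in LHS](gez0_abs (m := numq rho)) // numq_ge0 contact_ge0.
Qed.

(** [t] is the truncation of gamma, not the variable, which is [fT]. Primes mark the same series
    rewritten in y^(1/D), and [P] is f(X + gamma, y) in that variable. *)
Let a := fser gamma.
Let t := fser (trunc_root gamma rho).
Let a' := stretch d a.
Let t' := stretch d t.
Let P := liftF f D \Po ('X + a'%:P).

Let P_stretch : P = map_poly (stretch d) (liftF f N \Po ('X + a%:P)).
Proof. by rewrite map_comp_poly rmorphD /= map_polyX map_polyC map_stretch_liftF. Qed.

Let P_neq0 : P != 0.
Proof.
apply: contraNneq (liftF_neq0 D_gt0 f_reg) => P0.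
by rewrite -(comp_XaddCK (liftF f D) a') -/P P0 comp_poly0.
Qed.

Lemma ex_initial_form (r : nat) : exists w (G : {poly fps C}) i,
  P \Po (fT ^+ r *: 'X) = (fT ^+ w)%:P * G /\ G`_i 0%N != 0.
Proof.
have scaled_neq0 : P \Po (fT ^+ r *: 'X) != 0.
  apply: contraNneq P_neq0 => /polyP Pr; apply/eqP/polyP => i.
  apply: (@fTM_inj _ (r * i)); rewrite coef0 mulr0 exprM.
  by rewrite -coef_comp_scaleX Pr coef0.
by have [w [G [PG [i Gi]]]] := fps_poly_content scaled_neq0; exists w, G, i.
Qed.

Lemma ex_root_mult : exists m,
  [/\ is_mult f gamma m, forall i, (i < m)%N -> P`_i = 0 & P`_m != 0].
Proof.
have ex_coef : exists m, P`_m != 0.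
  by exists (size P).-1; rewrite -lead_coefE lead_coef_eq0.
case: (ex_minnP ex_coef) => m Pm m_min; exists m.
have low i : (i < m)%N -> P`_i = 0.
  by move=> im; apply/eqP; apply: contraTT im => /m_min; rewrite -leqNgt.
split=> //; apply: is_multP => [i im|].
  apply: (stretch_inj d_gt0); have := low i im.
  by rewrite P_stretch coef_map => ->; rewrite rmorph0.
by apply: contraNneq Pm => Pm0; rewrite P_stretch coef_map Pm0 raddf0.
Qed.

Variables (r w : nat) (G : {poly fps C}).
Hypothesis rE : rho * D%:R = r%:R.
Hypothesis PG : P \Po (fT ^+ r *: 'X) = (fT ^+ w)%:P * G.
Variable i0 : nat.
Hypothesis Gi0 : G`_i0 0%N != 0.

Let le_rho k : (k%:R / D%:R <= rho) = (k <= r)%N.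
Proof. by rewrite ler_pdivrMr ?ltr0n // rE ler_nat. Qed.

Let lt_rho k : (k%:R / D%:R < rho) = (k < r)%N.
Proof. by rewrite ltr_pdivrMr ?ltr0n // rE ltr_nat. Qed.

Let eq_rho k : (k%:R / D%:R == rho) = (k == r)%N.
Proof. by rewrite -(inj_eq (mulIf D_neq0)) divfK // rE eqr_nat. Qed.

Let t'E k : t' k = if (k <= r)%N then a' k else 0.
Proof.
rewrite -le_rho -(pcoef_frac t' _ D_gt0) -(pcoef_frac a' _ D_gt0).
rewrite !pcoef_stretch //; exact: pcoef_trunc.
Qed.

(** The truncation keeps the exponent rho itself, so the tail starts strictly later: hence the extra
    factor [fT]. *)
Let ex_tail : exists e : fps C, a' = t' + fT ^+ r * (fT * e).
Proof.
have /eqmP[e ae] : eqm r.+1 a' t' by move=> k; rewrite ltnS t'E => ->.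
by exists e; rewrite ae exprSr mulrA.
Qed.

(* Replacing gamma by its truncation moves X by an amount of order > rho, which
   does not affect the rho-initial form [map_poly coef0_fps G]. *)
Lemma initial_form_trunc : exists2 Gt,
  (liftF f D \Po ('X + t'%:P)) \Po (fT ^+ r *: 'X) = (fT ^+ w)%:P * Gt &
  map_poly (@coef0_fps C) Gt = map_poly (@coef0_fps C) G.
Proof.
(* Once X is scaled by y^rho, removing the tail is the translation by [- fT * e], trivial at [fT] =
   0. *)
have [e ae] := ex_tail; exists (G \Po ('X - (fT * e)%:P)); last first.
  rewrite map_comp_poly rmorphB /= map_polyX map_polyC /= rmorphM /=.
  by rewrite /coef0_fps /= coefX mul0r subr0 comp_polyXr.
have -> : (fT ^+ w)%:P * (G \Po ('X - (fT * e)%:P)) =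
          ((fT ^+ w)%:P * G) \Po ('X - (fT * e)%:P) by rewrite comp_polyM comp_polyC.
rewrite -PG -!comp_polyA !comp_polyD !comp_polyZ !comp_polyX !comp_polyC; congr (_ \Po _).
by rewrite ae -!mul_polyC !(rmorphD, rmorphM) /=; ring.
Qed.

Lemma initial_form_low m :
  (forall i, (i < m)%N -> P`_i = 0) -> forall i, (i < m)%N -> G`_i = 0.
Proof.
move=> low i im; apply: (@fTM_inj _ w); rewrite mulr0.
by rewrite -coefCM -PG coef_comp_scaleX low ?mulr0.
Qed.

Let ramified_root_P M (x : fps C) : (0 < M)%N -> (map_poly (stretch M) G).[x] = 0 ->
  (liftF f (D * M)).[stretch M a' + fT ^+ (M * r) * x] = 0.
Proof.
move=> M0 Gx; rewrite -map_stretch_liftF //.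
have : (map_poly (stretch M) (P \Po (fT ^+ r *: 'X))).[x] = 0.
  by rewrite PG rmorphM hornerM Gx mulr0.
rewrite !map_comp_poly map_polyZ rmorphD /= map_polyX map_polyC !horner_comp.
rewrite hornerZ hornerD !hornerX hornerC /= addrC => <-.
by rewrite rmorphXn /= stretch_fT // -exprM addrC.
Qed.

(* A root of G of positive order would be, after rescaling, a root of f
   differing from gamma only beyond rho. *)
Let ramified_root_eq0 M (x : fps C) : (0 < M)%N -> x 0%N = 0 ->
  (map_poly (stretch M) G).[x] = 0 -> x = 0.
Proof.
move=> M0 x0 Gx; have DM0 : (0 < D * M)%N by rewrite muln_gt0 D_gt0.
set b := stretch M a' + fT ^+ (M * r) * x.
pose g' := PSeries (D * M) b.
have a0 : a 0%N = 0 by exact: gamma_root.1.2.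
(* The bound includes k = M r because x has no constant term; thus the new root agrees with gamma at
   the exponent rho too. *)
have low k : (k <= M * r)%N -> (fT ^+ (M * r) * x) k = 0.
  by rewrite coef_fTM leq_eqVlt => /orP[/eqP ->|->] //; rewrite ltnn subnn.
have rg' : is_np_root f g'.
  have pv : ps_valid g'.
    by split=> //; rewrite /= -[LHS]/(b 0%N) coef_fpsD stretch0E low // addr0 stretch0E.
  by apply/(np_rootE f pv); apply: ramified_root_P.
have gammaE q : pcoef gamma q = pcoef (PSeries (D * M) (stretch M a')) q.
  by rewrite pcoef_stretch // pcoef_stretch.
have /= agr := contact_unique rho_contact gamma_root rg' _.
have eq_g : peq gamma g'.
  apply: agr => q q_rho; rewrite gammaE.
  case: (pcoefP g' q) => [[k [qk ->]]|[qN ->]].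
    rewrite (pcoef_nat _ qk) coef_fpsD low ?addr0 //.
    have : q * (D * M)%:R <= rho * (D * M)%:R by rewrite ler_pM2r // ltr0n.
    by rewrite qk natrM mulrA rE -natrM ler_nat mulnC.
  by case: (pcoefP (PSeries (D * M) (stretch M a')) q) => [[k [qk]]|[]] //; case: (qN k).
apply: (@fTM_inj _ (M * r)); rewrite mulr0; apply: fpsP => k.
have := eq_g (k%:R / (D * M)%:R); rewrite gammaE !pcoef_frac // coef_fpsD.
by rewrite -[LHS]addr0 => /addrI <-.
Qed.

Lemma initial_form_mult m : (forall i, (i < m)%N -> P`_i = 0) -> P`_m != 0 -> G`_m 0%N != 0.
Proof.
move=> low top; have Glow := initial_form_low low.
apply/negP => /eqP Gm0; pose H := drop_poly m G.
have GE : G = 'X^m * H.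
  apply/polyP => i; rewrite coefXnM; case: ltnP => [/Glow //|mi].
  by rewrite coef_drop_poly subnK.
have mi0 : (m <= i0)%N by rewrite leqNgt; apply: contraNN Gi0 => /Glow ->.
have H0 : H`_0 0%N = 0 by rewrite coef_drop_poly.
have Hi0 : H`_(i0 - m) 0%N != 0 by rewrite coef_drop_poly subnK.
have charC n : n.+1%:R != 0 :> C by rewrite pnatr_eq0.
have [M [x [M0 x0 Hx]]] := newton_puiseux charC H0 Hi0.
(* The root being 0, the constant coefficient of H, which is G_m, vanishes as a whole series and not
   only at [fT] = 0. Then P_m = 0, against [top]. *)
have x_eq0 : x = 0.
  apply: (ramified_root_eq0 M0 x0); rewrite GE rmorphM hornerM.
  by rewrite [X in _ * X]Hx mulr0.
move: Hx; rewrite x_eq0 horner_coef0 coef_map -[RHS](rmorph0 (stretch M)).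
move/(stretch_inj M0); rewrite /H coef_drop_poly add0n => Gm.
case/eqP: top; apply: (@fTM_inj _ (r * m)); rewrite mulr0 exprM.
by rewrite -coef_comp_scaleX PG coefCM Gm mulr0.
Qed.

Let coefs_on_line i j : i%:R * rho + j%:R / N%:R = w%:R / D%:R -> (r * i + j * d)%N = w.
Proof.
move=> line; apply/eqP; rewrite -(eqr_nat rat) natrD (natrM _ r i) (natrM _ j d) -rE.
move/(congr1 ( *%R^~ D%:R)): line; rewrite divfK // => <-; apply/eqP.
rewrite mulrDl; congr (_ + _); first by ring.
by rewrite /D natrM mulrA divfK // pnatr_eq0 -lt0n.
Qed.

Let line_of_coefs i j : (r * i + j * d)%N = w -> i%:R * rho + j%:R / N%:R = w%:R / D%:R.
Proof.
move=> <-; apply: (mulIf D_neq0); rewrite divfK //.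
rewrite natrD (natrM _ r i) (natrM _ j d) -rE mulrDl.
congr (_ + _); first by ring.
by rewrite /D natrM mulrA divfK // pnatr_eq0 -lt0n.
Qed.

Let shiftc_stretch i j :
  shiftc f (trunc_root gamma rho) i j = (liftF f D \Po ('X + t'%:P))`_i (j * d)%N.
Proof.
rewrite shiftcE -(stretch_mul _ j d_gt0) -[in RHS](map_stretch_liftF f N d_gt0).
rewrite -/t -[in RHS](map_polyX (stretch d)) -[in RHS]map_polyC -rmorphD -map_comp_poly.
by rewrite coef_map.
Qed.

(** On the line, c_ij is the coefficient of X^i and of degree w in the rescaled polynomial; dividing
    by [fT ^+ w] leaves the constant term of the i-th coefficient, unchanged by truncation. *)
Lemma shiftc_on_line i j : i%:R * rho + j%:R / N%:R = w%:R / D%:R ->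
  shiftc f (trunc_root gamma rho) i j = G`_i 0%N.
Proof.
move/coefs_on_line => line; rewrite shiftc_stretch.
have [Gt PtG Gt0] := initial_form_trunc.
have -> : G`_i 0%N = Gt`_i 0%N by rewrite -!coef0_map Gt0.
have := congr1 (fun Q : {poly fps C} => Q`_i w) PtG.
rewrite coef_comp_scaleX coefCM -exprM !coef_fTM ltnn subnn -line.
by rewrite ltnNge leq_addr addKn.
Qed.

(** The translate by the truncation is already defined over y^(1/N), so its nonzero terms in y^(1/D)
    have degree divisible by d; the quotient is j. *)
Lemma ex_coef_on_line i : G`_i 0%N != 0 ->
  exists j : nat, i%:R * rho + j%:R / N%:R = w%:R / D%:R.
Proof.
have [Gt PtG Gt0] := initial_form_trunc.
have -> : G`_i 0%N = Gt`_i 0%N by rewrite -!coef0_map Gt0.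
have -> : Gt`_i 0%N = ((fT ^+ w)%:P * Gt)`_i w.
  by rewrite coefCM coef_fTM ltnn subnn.
rewrite -PtG coef_comp_scaleX -exprM coef_fTM.
case: ltnP => [_|ri]; first by rewrite eqxx.
have -> : liftF f D \Po ('X + t'%:P) = map_poly (stretch d) (liftF f N \Po ('X + t%:P)).
  by rewrite map_comp_poly rmorphD /= map_polyX map_polyC map_stretch_liftF.
rewrite coef_map /stretch /=; case: ifP => [/dvdnP[j wj] _|_]; last by rewrite eqxx.
by exists j; apply: line_of_coefs; rewrite -wj subnKC.
Qed.

(** The truncation already has a term at rho, so c replaces its coefficient and the correction is c
    minus that coefficient. *)
Lemma rho_approxE (c : R) :
  fser (rho_approx (trunc_root gamma rho) rho c) = t' + fT ^+ r * fC (toC c - t' r).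
Proof.
apply: fpsP => k; rewrite coef_fpsD coef_fTM.
rewrite [LHS]/= -/N -/d -/D.
rewrite lt_rho eq_rho -(pcoef_stretch (fser (trunc_root gamma rho)) _ N_gt0 d_gt0).
rewrite (pcoef_frac _ _ D_gt0) -/t'.
case: (ltngtP k r) => [kr|kr|->]; first by rewrite addr0.
  by rewrite t'E leqNgt kr /= coefC subn_eq0 leqNgt kr addr0.
by rewrite subnn /= coefC eqxx addrC subrK.
Qed.

(** Substitution gives y^(w/D) times a series whose constant term is the initial form at z, nonzero
    by hypothesis. *)
Lemma ord_rho_approx (c : R) :
  ~~ root (map_poly (@coef0_fps C) G) (toC c - t' r) ->
  is_ord (evalc f (rho_approx (trunc_root gamma rho) rho c)) (w%:R / D%:R).
Proof.
move=> nroot; have [Gt PtG Gt0] := initial_form_trunc.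
set z := toC c - t' r in nroot *.
have vE : valF f (rho_approx (trunc_root gamma rho) rho c) = fT ^+ w * Gt.[fC z].
  rewrite /valF rho_approxE -/z addrC -horner_comp_XaddC.
  have := congr1 (fun Q : {poly fps C} => Q.[fC z]) PtG.
  by rewrite horner_comp hornerZ hornerX hornerM hornerC.
have Gtz : Gt.[fC z] 0%N = (map_poly (@coef0_fps C) G).[z].
  by rewrite coef0_horner Gt0 /= coefC.
split; first by rewrite evalcE vE (pcoef_frac _ _ D_gt0) coef_fTM ltnn subnn Gtz.
move=> q qw; rewrite evalcE vE.
set ps := PSeries _ _; case: (pcoefP ps q) => [[k [qk ->]]|[_ ->] //].
by rewrite [LHS]coef_fTM -(ltr_nat rat) -qk -ltr_pdivlMr ?ltr0n // qw.
Qed.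

End MultiplicityFormula.

(** * Assembly of part (ii) and of the whole theorem *)

Lemma root_multiplicity (R : realType) (f : {poly {poly R}}) (gamma : pseries (complex R))
    (rho : rat) :
  regular_in_x f -> is_np_root f gamma -> contact_order f gamma rho ->
  exists S : seq R, forall c : R, c \notin S ->
    exists o : rat,
      is_ord (evalc f (rho_approx (trunc_root gamma rho) rho c)) o /\
      exists m : nat, is_mult f gamma m /\
        (exists j : nat, m%:R * rho + j%:R / (pden gamma)%:R = o /\
           shiftc f (trunc_root gamma rho) m j != 0) /\
        (forall i j : nat, i%:R * rho + j%:R / (pden gamma)%:R = o ->
           shiftc f (trunc_root gamma rho) i j != 0 -> (m <= i)%N).
Proof.
move=> f_reg rg co; have [r rE] := contact_integral rg co.
have [w [G [i0 [PG Gi0]]]] := ex_initial_form rho f_reg rg r.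
have [m [m_mult low top]] := ex_root_mult rho f_reg rg.
pose g := map_poly (@coef0_fps (complex R)) G.
have g_neq0 : g != 0.
  by apply: contraNneq Gi0 => g0; rewrite -coef0_map -/g g0 coef0.
have Gm := initial_form_mult rg co rE PG Gi0 low top.
(* With [Gm], this makes m the first index whose coefficient in the initial form is nonzero, which
   is the minimum sought. *)
have Glow i : (i < m)%N -> G`_i 0%N = 0 by move=> im; rewrite (initial_form_low PG low).
have [S HS] := finite_real_roots
  (stretch `|denq rho| (fser (trunc_root gamma rho)) r) g_neq0.
exists S => c /HS nroot; exists (w%:R / (pden gamma * `|denq rho|)%:R).
split; first exact: ord_rho_approx nroot.
exists m; split=> //; split=> [|i j line].
  have [j line] := ex_coef_on_line rg rE PG Gm.
  by exists j; split=> //; rewrite (shiftc_on_line rg rE PG line).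
rewrite (shiftc_on_line rg rE PG line); apply: contraR; rewrite -ltnNge => /Glow.
by move/eqP.
Qed.

Theorem theorem4p1 (R : realType) (f : {poly {poly R}}) (gamma : pseries (complex R))
  (rho : rat) :
  regular_in_x f -> is_np_root f gamma -> contact_order f gamma rho ->
  [/\ (* (i) *)
      (ps_real (trunc_root gamma rho) -> ps_real gamma),
      (* (ii) for generic real c (all c outside a finite set) *)
      (exists S : seq R, forall c : R, c \notin S ->
         exists o : rat,
           is_ord (evalc f (rho_approx (trunc_root gamma rho) rho c)) o /\
           exists m : nat, is_mult f gamma m /\
             (exists j : nat, m%:R * rho + j%:R / (pden gamma)%:R = o /\
                shiftc f (trunc_root gamma rho) m j != 0) /\
             (forall i j : nat, i%:R * rho + j%:R / (pden gamma)%:R = o ->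
                shiftc f (trunc_root gamma rho) i j != 0 -> (m <= i)%N))
    & (* (iii) *)
      (forall g h : {poly {poly R}}, regular_in_x g -> is_gcd f g h ->
         (exists xi, is_np_root h xi /\ ord_gt (diffc (trunc_root gamma rho) xi) rho) ->
         is_np_root g gamma)].
Proof.
move=> f_reg rg co; split; first exact: root_real rg co.
  exact: root_multiplicity.
move=> g h _ [hf [hg _]] [xi [rxi xi_gt]].
exact: root_of_gcd rg co hf hg rxi xi_gt.
Qed.
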